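(* Let $X$ and $Y$ be Hilbert spaces, let $f:X\to(-\infty,+\infty]$ be proper, lsc and $\rho$-weakly convex, let $g:Y\to(-\infty,+\infty]$ be proper, lsc and convex, and let $L:X\to Y$ be a bounded linear operator. Let $(x_n)_{n\in\mathbb N},(y_n)_{n\in\mathbb N}$ be the sequences generated by the primal-first primal-dual algorithm (described in the context). Assume that the stepsizes $\tau,\sigma$ satisfy $\sigma\rho+\sqrt{\sigma\tau}\,\Vert L\Vert<1$, and that the Lagrangian $\mathcal L$ is inf-sharp with constant $\mu>0$ with respect to its set of saddle points $S\neq\emptyset$. If the starting point $(x_0,y_0)$ satisfies $$\operatorname{dist}((x_0,y_0),S)<\frac{\mu}{\max\left\{\frac1{2\sigma},\frac1{2\tau}\right\}-A_1},\qquad A_1=\min\left\{\frac{1-\theta\sqrt{\sigma\tau}\Vert L\Vert}{2\tau},\ \frac{1-\sigma\rho-\sqrt{\sigma\tau}\Vert L\Vert}{2\sigma}\right\},$$ then $(x_n,y_n)$ converges to a saddle point of $\mathcal L$.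
   Context: Hilbert spaces are real. A function $f:X\to(-\infty,+\infty]$ is $\rho$-weakly convex ($\rho\ge 0$) if $f(\lambda x+(1-\lambda)y)\le\lambda f(x)+(1-\lambda)f(y)+\lambda(1-\lambda)\frac{\rho}{2}\Vert x-y\Vert^2$ for all $x,y\in X$, $\lambda\in[0,1]$ (equivalently, $f+\frac{\rho}{2}\Vert\cdot\Vert^2$ is convex). The conjugate is $g^*(y)=\sup_{w\in Y}\{\langle y,w\rangle-g(w)\}$. The adjoint of $L$ is $L^*$. $\operatorname{dom}(g\circ L)=\{x\in X: g(Lx)<+\infty\}$. The Lagrangian is the extended-real-valued function $\mathcal L(x,y)=f(x)+\langle Lx,y\rangle-g^*(y)$ on $X\times Y$. A pair $(x^*,y^* )\in X\times Y$ is a saddle point of $\mathcal L$ if $\mathcal L(x^*,y)\le\mathcal L(x^*,y^* )\le\mathcal L(x,y^* )$ for all $(x,y)\in X\times Y$; $S$ is the set of saddle points. The norm on $X\times Y$ is $\Vert(x,y)\Vert=\sqrt{\Vert x\Vert^2+\Vert y\Vert^2}$, and $\operatorname{dist}(z,S)=\inf_{\bar z\in S}\Vert z-\bar z\Vert$. The modified gap function is $\mathcal H_{\mathcal L}(x,y)=\inf_{(\bar x,\bar y)\in S}\{\mathcal L(x,\bar y)-\mathcal L(\bar x,y)\}$. $\mathcal L$ is inf-sharp with constant $\mu>0$ if $\mathcal H_{\mathcal L}(z)\ge\mu\operatorname{dist}(z,S)$ for all $z\in X\times Y$. Primal-first primal-dual algorithm: choose $x_0\in\operatorname{dom} f\cap\operatorname{dom}(g\circ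 L)$, $\bar x_0=x_0$, $y_0\in Y$, and $\tau,\sigma>0$, $\theta\in[0,1]$ with $\sigma\rho<1$ and $\sqrt{\sigma\tau}\Vert L\Vert<1$. For $n\ge0$: $x_{n+1}=\operatorname{argmin}_{x\in X}\ f(x)+\frac1{2\sigma}\Vert x-x_n+\sigma L^*y_n\Vert^2$; $\bar x_{n+1}=x_{n+1}+\theta(x_{n+1}-x_n)$; $y_{n+1}=\operatorname{argmin}_{y\in Y}\ g^*(y)+\frac1{2\tau}\Vert y-y_n-\tau L\bar x_{n+1}\Vert^2$. *)

(* Defs.v *)
From HB Require Import structures.
From mathcomp Require Import all_boot all_order all_algebra.
From mathcomp Require Import all_classical all_reals all_analysis.

Set Implicit Arguments.
Unset Strict Implicit.
Unset Printing Implicit Defensive.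

Import Order.TTheory GRing.Theory Num.Theory.
Import numFieldNormedType.Exports.

Local Open Scope classical_set_scope.
Local Open Scope ring_scope.

HB.mixin Record CompleteNormedModule_isHilbert (R : realType) V
    of CompleteNormedModule R V := {
  dotp : V -> V -> R ;
  dotpC : forall x y, dotp x y = dotp y x ;
  dotp_linearl : forall (a : R) x y z,
    dotp (a *: x + y) z = a * dotp x z + dotp y z ;
  dotpxx : forall x, dotp x x = `|x| ^+ 2
}.

#[short(type="hilbertType")]
HB.structure Definition Hilbert (R : realType) :=
  { V of CompleteNormedModule_isHilbert R V & CompleteNormedModule R V }.

Section Functions.
Context {R : realType} {X : hilbertType R}.
Implicit Types (h : X -> \bar R) (x y : X).

Definition proper_fun h := (forall x, h x != -oo%E) /\ (exists x, (h x < +oo)%E).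

Definition dom h : set X := [set x | (h x < +oo)%E].

(* At lambda = 0 or 1 the library convention 0 * +oo = 0 makes the inequality
   trivial, as it should be. *)
Definition weakly_convex (rho : R) h := forall x y (lambda : R),
  0 <= lambda <= 1 ->
  (h (lambda *: x + (1 - lambda) *: y)%R <=
   lambda%:E * h x + (1 - lambda)%:E * h y +
   (lambda * (1 - lambda) * (rho / 2) * `|x - y| ^+ 2)%:E)%E.

Definition convex h := forall x y (lambda : R),
  0 <= lambda <= 1 ->
  (h (lambda *: x + (1 - lambda) *: y)%R <=
   lambda%:E * h x + (1 - lambda)%:E * h y)%E.

Definition conjugate h : X -> \bar R := fun y =>
  ereal_sup [set ((dotp y w)%:E - h w)%E | w in [set: X]].

Definition argmin h : set X := [set x | forall x', (h x <= h x')%E].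

End Functions.

Section Operators.
Context {R : realType} {X Y : hilbertType R}.
Implicit Type L : {linear X -> Y}.

Definition bounded_operator L := exists M : R, forall x, `|L x| <= M * `|x|.

Definition opnorm L : R := sup [set `|L x| | x in [set x : X | `|x| <= 1]].

(* For bounded L the selected vector exists (Riesz representation) and is
   unique. *)
Definition adjoint L (y : Y) : X :=
  xget 0 [set z : X | forall x, dotp (L x) y = dotp x z].

End Operators.

Section Saddle.
Context {R : realType} {X Y : hilbertType R}.
Variables (f : X -> \bar R) (g : Y -> \bar R) (L : {linear X -> Y}).

(* In the library +oo - +oo = -oo, so that the value is -oo when x \notin dom f
   and y \notin dom g^*.  For f and g proper and g convex lsc this choice is
   immaterial below: a saddle point (xs, ys) has f xs and g^* ys finite under
   any convention, and only the values at (x, ys) and (xs, y) are used. *)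
Definition lagrangian (x : X) (y : Y) : \bar R :=
  (f x + (dotp (L x) y)%:E - conjugate g y)%E.

Definition saddle_points : set (X * Y) :=
  [set s | forall x y,
     (lagrangian s.1 y <= lagrangian s.1 s.2)%E /\
     (lagrangian s.1 s.2 <= lagrangian x s.2)%E].

(* The library norm on X * Y is the maximum norm; it induces the same
   topology. *)
Definition prod_norm (z : X * Y) : R := Num.sqrt (`|z.1| ^+ 2 + `|z.2| ^+ 2).

Definition dist (z : X * Y) (S : set (X * Y)) : R :=
  inf [set prod_norm (z - s) | s in S].

Definition modified_gap (z : X * Y) : \bar R :=
  ereal_inf [set (lagrangian z.1 s.2 - lagrangian s.1 z.2)%E
            | s in saddle_points].

Definition inf_sharp (mu : R) := 0 < mu /\
  forall z : X * Y, ((mu * dist z saddle_points)%:E <= modified_gap z)%E.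

(* Each proximal step asserts membership in the set of minimizers; this set is a
   singleton under the stepsize conditions. *)
Record primal_first (rho sigma tau theta : R)
    (x xbar : nat -> X) (y : nat -> Y) : Prop := PrimalFirst {
  pf_sigma_gt0 : 0 < sigma ;
  pf_tau_gt0 : 0 < tau ;
  pf_theta_itv : 0 <= theta <= 1 ;
  pf_sigma_rho : sigma * rho < 1 ;
  pf_sigma_tau : Num.sqrt (sigma * tau) * opnorm L < 1 ;
  pf_x0_dom : (dom f `&` dom (g \o L)) (x 0%N) ;
  pf_xbar0 : xbar 0%N = x 0%N ;
  pf_x_step : forall n, argmin (fun u : X => f u +
    ((2 * sigma)^-1 * `|u - x n + sigma *: adjoint L (y n)| ^+ 2)%:E)%E
    (x n.+1) ;
  pf_xbar_step : forall n, xbar n.+1 = x n.+1 + theta *: (x n.+1 - x n) ;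
  pf_y_step : forall n, argmin (fun v : Y => conjugate g v +
    ((2 * tau)^-1 * `|v - y n - tau *: L (xbar n.+1)| ^+ 2)%:E)%E
    (y n.+1)
}.

Definition stepsize_A1 (rho sigma tau theta : R) : R :=
  Num.min ((1 - theta * Num.sqrt (sigma * tau) * opnorm L) / (2 * tau))
          ((1 - sigma * rho - Num.sqrt (sigma * tau) * opnorm L)
             / (2 * sigma)).

End Saddle.

(* Main.v *)
Require Import Defs.
From HB Require Import structures.
From mathcomp Require Import all_boot all_order all_algebra.
From mathcomp Require Import all_classical all_reals all_analysis.
From mathcomp Require Import ring lra.

Set Implicit Arguments.
Unset Strict Implicit.
Unset Printing Implicit Defensive.

Import Order.TTheory GRing.Theory Num.Theory.
Import numFieldNormedType.Exports.

Local Open Scope classical_set_scope.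
Local Open Scope ring_scope.

(** Each proximal step minimizes a strongly convex function, so the minimizer
    p satisfies a quadratic growth inequality ([proximal_inequality]); weak
    convexity of f only lowers the modulus by rho / 2.  Adding the inequalities
    of the primal and the dual step at a saddle point s, and absorbing the two
    coupling terms with [opnorm_young], gives ([gap_decrease]), with
    M = max (1 / (2 sigma)) (1 / (2 tau)) and z n = (x n, y n),
      gap at s + A1 * |z (n+1) - s|^2 <= M * |z n - s|^2,
    where the gap at s is the Lagrangian at (x (n+1), s.2) minus the
    Lagrangian at (s.1, y (n+1)).

    Inf-sharpness bounds the gap below by mu * d (n+1), where d n is the
    distance of z n to the set S of saddle points.  Taking the infimum over s,
      mu * d (n+1) + A1 * d (n+1)^2 <= M * d n^2.
    The condition (M - A1) * d 0 < mu on the starting point is what makes this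
    recursion contract, so that d n decreases linearly ([dist_linear_rate]).
    Since A1 > 0, the first inequality, with the gap dropped, also bounds the
    increment |z (n+1) - z n| by a multiple of d n; hence z is a Cauchy
    sequence.  Its limit is at distance 0 from S, and S is closed because f and
    the conjugate of g are lower semicontinuous ([closed_saddle_points]).

    Two facts make this work with extended values.  Inf-sharpness excludes
    that the conjugate of g is +oo everywhere ([inf_sharp_conjugate_dom]), so
    saddle points and iterates have finite values.  The adjoint in the primal
    step satisfies its defining identity by the Riesz representation theorem
    ([riesz_representation], [adjointP]). *)

(** * Inner products and bounded operators *)

Section InnerProduct.
Context {R : realType} {X : hilbertType R}.
Implicit Types (a : R) (x y z : X).

Lemma dotp0l x : dotp 0 x = 0.
Proof.
have := dotp_linearl 1 0 0 x; rewrite scaler0 addr0 mul1r => h.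
by apply: (addrI (dotp 0 x)); rewrite addr0 -h.
Qed.

Lemma dotpDl x y z : dotp (x + y) z = dotp x z + dotp y z.
Proof. by rewrite -[x in LHS]scale1r dotp_linearl mul1r. Qed.

Lemma dotpZl a x z : dotp (a *: x) z = a * dotp x z.
Proof. by rewrite -[a *: x]addr0 dotp_linearl dotp0l addr0. Qed.

Lemma dotpNl x z : dotp (- x) z = - dotp x z.
Proof. by rewrite -scaleN1r dotpZl mulN1r. Qed.

Lemma dotpBl x y z : dotp (x - y) z = dotp x z - dotp y z.
Proof. by rewrite dotpDl dotpNl. Qed.

Lemma dotpDr x y z : dotp z (x + y) = dotp z x + dotp z y.
Proof. by rewrite dotpC dotpDl !(dotpC _ z). Qed.

Lemma dotpZr a x z : dotp z (a *: x) = a * dotp z x.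
Proof. by rewrite dotpC dotpZl (dotpC _ z). Qed.

Lemma dotpBr x y z : dotp z (x - y) = dotp z x - dotp z y.
Proof. by rewrite dotpC dotpBl !(dotpC _ z). Qed.

Lemma normD_sqr x y : `|x + y| ^+ 2 = `|x| ^+ 2 + 2 * dotp x y + `|y| ^+ 2.
Proof. by rewrite -!dotpxx dotpDl !dotpDr (dotpC y x); ring. Qed.

Lemma normB_sqr x y : `|x - y| ^+ 2 = `|x| ^+ 2 - 2 * dotp x y + `|y| ^+ 2.
Proof. by rewrite -!dotpxx dotpBl !dotpBr (dotpC y x); ring. Qed.

Lemma parallelogram x y :
  `|x + y| ^+ 2 + `|x - y| ^+ 2 = 2 * `|x| ^+ 2 + 2 * `|y| ^+ 2.
Proof. by rewrite normB_sqr normD_sqr; ring. Qed.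

Lemma norm_convex_comb a x y :
  `|a *: x + (1 - a) *: y| ^+ 2 =
  a * `|x| ^+ 2 + (1 - a) * `|y| ^+ 2 - a * (1 - a) * `|x - y| ^+ 2.
Proof.
rewrite normB_sqr normD_sqr -!dotpxx !(dotpZl, dotpZr).
ring.
Qed.

(** The triangle inequality, squared, is the Cauchy-Schwarz inequality. *)
Lemma dotp_le_norm x y : dotp x y <= `|x| * `|y|.
Proof.
have : `|x + y| ^+ 2 <= (`|x| + `|y|) ^+ 2.
  by rewrite lerXn2r ?nnegrE ?addr_ge0// ler_normD.
by rewrite normD_sqr; lra.
Qed.

Lemma norm_sqr_continuous : continuous (fun x : X => `|x| ^+ 2 : R).
Proof. by move=> x; apply: cvgM; exact: cvg_norm. Qed.

Lemma dotp_continuous z : continuous (dotp z : X -> R).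
Proof.
(* By polarization, since the norm is continuous. *)
have -> : dotp z = fun x => (`|z + x| ^+ 2 - `|z| ^+ 2 - `|x| ^+ 2) / 2 :> R.
  by apply/funext => x; rewrite normD_sqr; field.
move=> x; apply: cvgMr_tmp; apply: cvgB; last exact: norm_sqr_continuous.
apply: cvgB; last exact: cvg_cst.
apply: (@cvg_comp _ _ _ (fun x => z + x) (fun x => `|x| ^+ 2) _ (nbhs (z + x))).
  by apply: cvgD; [exact: cvg_cst|exact: cvg_id].
exact: norm_sqr_continuous.
Qed.

End InnerProduct.

Lemma cvg_geometric_increments (R : realType) (V : completeNormedModType R)
    (C q : R) (u : nat -> V) : 0 <= q < 1 ->
  (forall n, `|u n.+1 - u n| <= C * q ^+ n) -> cvgn u.
Proof.
move=> /andP[q0 q1] hu.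
have : cvgn (series (telescope u)).
  apply: normed_cvg; apply: (@series_le_cvg _ _ (geometric C q)).
  - by move=> n; exact: normr_ge0.
  - by move=> n; exact: le_trans (normr_ge0 _) (hu n).
  - exact: hu.
  - by apply: is_cvg_geometric_series; rewrite ger0_norm.
rewrite telescopeK => /(is_cvgD (is_cvg_cst (u 0%N))).
by congr (cvgn _); apply/funext => n /=; rewrite addrC subrK.
Qed.

Section BoundedOperator.
Context {R : realType} {X Y : hilbertType R} (L : {linear X -> Y}).
Hypothesis L_bounded : bounded_operator L.

Lemma opnorm_has_ubound : has_ubound [set `|L x| | x in [set x | `|x| <= 1]].
Proof.
have [M LM] := L_bounded.
exists `|M| => _ [u /= u1 <-]; apply: le_trans (LM u) _.
by rewrite (le_trans (ler_norm _))// normrM normr_id ler_piMr.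
Qed.

Lemma opnorm_bound x : `|L x| <= opnorm L * `|x|.
Proof.
have [->|x0] := eqVneq x 0; first by rewrite linear0 !normr0 mulr0.
have nx : 0 < `|x| by rewrite normr_gt0.
rewrite -ler_pdivrMr//.
apply: (ub_le_sup opnorm_has_ubound).
exists (`|x|^-1 *: x) => /=.
  by rewrite normrZ normfV normr_id mulVf ?gt_eqF.
by rewrite linearZ normrZ normfV normr_id mulrC.
Qed.

Lemma opnorm_ge0 : 0 <= opnorm L.
Proof.
apply: (ub_le_sup opnorm_has_ubound).
by exists 0 => /=; rewrite ?linear0 normr0.
Qed.

Lemma bounded_operator_continuous : continuous L.
Proof.
apply: bounded_linear_continuous; apply/linear_boundedP.
exists (opnorm L + 1); split; first exact: num_real.
by move=> r hr x; rewrite (le_trans (opnorm_bound x))// ler_wpM2r//; lra.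
Qed.

(** The weights are those of the distance terms in the proximal inequalities,
    so that each coupling term is absorbed by them at the relative cost
    sqrt (sigma * tau) * |L|.  After Cauchy-Schwarz it is the inequality
    0 <= (sqrt tau * |u| - sqrt sigma * |v|)^2. *)
Lemma opnorm_young (sigma tau : R) u v : 0 < sigma -> 0 < tau ->
  dotp (L u) v <= Num.sqrt (sigma * tau) * opnorm L *
    ((2 * sigma)^-1 * `|u| ^+ 2 + (2 * tau)^-1 * `|v| ^+ 2).
Proof.
move=> s0 t0.
have sp : 0 < Num.sqrt sigma by rewrite sqrtr_gt0.
have tp : 0 < Num.sqrt tau by rewrite sqrtr_gt0.
rewrite -{2}(sqr_sqrtr (ltW s0)) -{2}(sqr_sqrtr (ltW t0)) sqrtrM ?(ltW s0)//.
apply: le_trans (dotp_le_norm _ _) _.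
apply: (@le_trans _ _ (opnorm L * (`|u| * `|v|))).
  by rewrite mulrA ler_wpM2r// opnorm_bound.
set a := Num.sqrt sigma in sp *; set b := Num.sqrt tau in tp *.
rewrite (mulrC (a * b)) -[leRHS]mulrA ler_wpM2l ?opnorm_ge0//.
rewrite -subr_ge0.
have -> : a * b * ((2 * a ^+ 2)^-1 * `|u| ^+ 2 + (2 * b ^+ 2)^-1 * `|v| ^+ 2)
   - `|u| * `|v| = (b * `|u| - a * `|v|) ^+ 2 / (2 * a * b).
  by field; rewrite !gt_eqF.
by rewrite divr_ge0 ?sqr_ge0// !mulr_ge0 ?ltW.
Qed.

End BoundedOperator.

(** * Existence of the adjoint *)

Section Riesz.
Context {R : realType} {X : hilbertType R}.

(** The representing vector is the minimizer of the quadratic functional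
    |z|^2 - 2 phi z: by the parallelogram identity a minimizing sequence is
    Cauchy, and the first-order condition at its limit is the representation. *)
Lemma riesz_representation (phi : {linear X -> R^o}) (C : R) :
  continuous phi -> (forall x, `|phi x| <= C * `|x|) ->
  exists z, forall x, phi x = dotp x z.
Proof.
move=> phi_cont phi_le.
pose J (z : X) : R := `|z| ^+ 2 - 2 * phi z.
have phiD u v : phi (u + v) = phi u + phi v :> R by rewrite linearD.
have phiZ a u : phi (a *: u) = a * phi u :> R by rewrite linearZ.
have J_lb z : - C ^+ 2 <= J z.
  have := sqr_ge0 (`|z| - C); have := le_trans (ler_norm _) (phi_le z).
  by rewrite /J sqrrB; lra.
pose m := inf (range J).
have m_le z : m <= J z.
  by apply: ge_inf; [exists (- C ^+ 2) => _ [u _ <-]|exists z].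
have inf_ok : has_inf (range J).
  by split; [exists (J 0); exists 0|exists (- C ^+ 2) => _ [u _ <-]].
have /choice[u hu] (n : nat) : exists z, J z < m + (4^-1) ^+ n.
  have e0 : 0 < (4^-1 : R) ^+ n by rewrite exprn_gt0// invr_gt0.
  by have [_ [z _ <-] hz] := inf_adherent e0 inf_ok; exists z.
have u_cvg : cvgn u.
  apply: (@cvg_geometric_increments _ _ 2 2^-1).
    by apply/andP; split; lra.
  move=> n; rewrite -(@ler_pXn2r _ 2)// ?nnegrE ?mulr_ge0 ?exprn_ge0 ?invr_ge0//.
  rewrite exprMn exprAC.
  have -> : (2^-1 ^+ 2 : R) = 4^-1 by field.
  have := hu n; have := hu n.+1; rewrite exprS.
  (* J at the midpoint is at least its infimum. *)
  have := m_le (2^-1 *: (u n.+1 + u n)).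
  have := parallelogram (u n.+1) (u n).
  have : 0 <= (4^-1 : R) ^+ n by rewrite exprn_ge0// invr_ge0.
  rewrite /J phiZ phiD normrZ ger0_norm ?invr_ge0// exprMn.
  have -> : (2^-1 ^+ 2 : R) = 4^-1 by field.
  set e := (_ : R) ^+ n; set a := `|u n.+1 + u n|; set b := `|u n.+1 - u n|.
  set p := `|u n.+1|; set q := `|u n|.
  set s := phi (u n.+1); set t := phi (u n).
  lra.
pose z := lim (u @ \oo).
have Jz : J z <= m.
  have J_cvg : J (u n) @[n --> \oo] --> J z.
    apply: (@cvg_comp _ _ _ u J _ (nbhs z)); first exact: u_cvg.
    apply: cvgB; first exact: norm_sqr_continuous.
    by apply: cvgM; [exact: cvg_cst|exact: phi_cont].
  have b_cvg : m + (4^-1) ^+ n @[n --> \oo] --> m + 0.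
    by apply: cvgD; [exact: cvg_cst|apply: cvg_expr; rewrite ger0_norm; lra].
  rewrite -[leRHS]addr0; apply: (ler_cvg_to J_cvg b_cvg).
  by apply: nearW => n; exact: ltW.
exists z => x.
(* t -> J (z + t x) - J z is a nonnegative quadratic vanishing at 0. *)
have Jt t : 0 <= t * (2 * (dotp x z - phi x)) + t ^+ 2 * `|x| ^+ 2.
  have := le_trans Jz (m_le (z + t *: x)).
  rewrite /J phiD phiZ normD_sqr dotpZr (dotpC z x) normrZ exprMn.
  rewrite real_normK ?num_real//.
  lra.
have [->|x0] := eqVneq x 0; first by rewrite linear0 dotp0l.
have x2 : 0 < `|x| ^+ 2 by rewrite exprn_gt0// normr_gt0.
set d := dotp x z - phi x in Jt.
(* The quadratic is evaluated at its minimizer. *)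
have := Jt (- d / `|x| ^+ 2).
have -> : - d / `|x| ^+ 2 * (2 * d) + (- d / `|x| ^+ 2) ^+ 2 * `|x| ^+ 2
  = - (d ^+ 2 / `|x| ^+ 2) by field; rewrite normr_eq0.
rewrite oppr_ge0 pmulr_lle0 ?invr_gt0// => d2.
have : d ^+ 2 == 0 by rewrite eq_le d2 sqr_ge0.
by rewrite sqrf_eq0 subr_eq0 => /eqP.
Qed.

Lemma adjointP (Y : hilbertType R) (L : {linear X -> Y}) (x : X) (y : Y) :
  bounded_operator L -> dotp (L x) y = dotp x (adjoint L y).
Proof.
move=> L_bounded; rewrite /adjoint; case: xgetP => [z _ -> //|none].
exfalso.
pose phi (u : X) : R^o := dotp (L u) y.
have phi_lin : linear phi by move=> a u v; rewrite /phi linearP dotp_linearl.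
pose lphi := GRing.isLinear.Build _ _ _ _ phi phi_lin.
pose Phi : {linear X -> R^o} := HB.pack phi lphi.
have [|u|z hz] := @riesz_representation Phi (opnorm L * `|y|);
  last by apply: none => u; exact: hz.
  have -> : Phi = dotp y \o L :> (X -> R).
    by apply/funext => u /=; rewrite dotpC.
  move=> u; apply: continuous_comp; last exact: dotp_continuous.
  exact: bounded_operator_continuous.
have := ler_wpM2r (normr_ge0 y) (opnorm_bound L_bounded u).
have := dotp_le_norm (L u) y; have := dotp_le_norm (- L u) y.
by rewrite dotpNl normrN mulrAC ler_norml /= /phi; lra.
Qed.

End Riesz.

(** * Proximal steps and conjugates *)

Section Proximal.
Context {R : realType} {X : hilbertType R}.
Implicit Types (h : X -> \bar R) (c rho : R).

Lemma argmin_dom h c (a p : X) : proper_fun h ->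
  argmin (fun u => h u + (c * `|u - a| ^+ 2)%:E)%E p -> h p \is a fin_num.
Proof.
move=> [hNy [u0 hu0]] /(_ u0).
have hu0_fin : h u0 \is a fin_num by rewrite fin_numE hNy lt_eqF.
rewrite -(fineK hu0_fin) -EFinD fin_numE hNy /=.
by case: (h p).
Qed.

(** Weak convexity costs rho / 2 of the modulus c of the quadratic term.  The
    inequality follows by comparing the minimizer p with the points of the
    segment from p to u and letting them tend to p. *)
Lemma proximal_inequality h rho c (a p u : X) (hp hu : R) :
  weakly_convex rho h ->
  argmin (fun v => h v + (c * `|v - a| ^+ 2)%:E)%E p ->
  h p = hp%:E -> h u = hu%:E ->
  hp + c * `|p - a| ^+ 2 + (c - rho / 2) * `|u - p| ^+ 2
    <= hu + c * `|u - a| ^+ 2.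
Proof.
move=> wc pmin hpE huE.
have segment (l : R) : 0 < l < 1 ->
  hp + c * `|p - a| ^+ 2 + (1 - l) * ((c - rho / 2) * `|u - p| ^+ 2)
    <= hu + c * `|u - a| ^+ 2.
  move=> /andP[l0 l1].
  have l01 : 0 <= l <= 1 by rewrite !ltW.
  have := le_trans (pmin (l *: u + (1 - l) *: p))
    (leeD2r _ (wc u p l l01)).
  rewrite hpE huE -!EFinM -!EFinD lee_fin.
  have -> : l *: u + (1 - l) *: p - a = l *: (u - a) + (1 - l) *: (p - a).
    rewrite !scalerBr addrACA -opprD -scalerDl.
    by rewrite (addrC l) subrK scale1r.
  rewrite norm_convex_comb.
  have -> : u - a - (p - a) = u - p by rewrite opprB addrA subrK.
  set A := `|p - a| ^+ 2; set B := `|u - a| ^+ 2; set D := `|u - p| ^+ 2.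
  by move=> H; rewrite -(ler_pM2l l0); lra.
(* Passage to the limit l -> 0: this l < 1 makes l * K at most e. *)
apply/ler_addgt0Pr => e e0.
set K := (c - rho / 2) * `|u - p| ^+ 2 in segment *.
have den : 0 < `|K| + e + 1 by rewrite ltr_wpDl ?addr_ge0// ltW.
pose l := e / (`|K| + e + 1).
have l0 : 0 < l by rewrite divr_gt0.
have l1 : l < 1 by rewrite ltr_pdivrMr// mul1r; have := normr_ge0 K; lra.
have lK : l * K <= e.
  rewrite /l mulrAC ler_pdivrMr//; apply: ler_wpM2l; first exact: ltW.
  by have := ler_norm K; lra.
by have := segment l; rewrite l0 l1 => /(_ isT); lra.
Qed.

End Proximal.

Section Conjugate.
Context {R : realType} {Y : hilbertType R} (g : Y -> \bar R).
Hypothesis g_proper : proper_fun g.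

Lemma conjugate_ge (y w : Y) : ((dotp y w)%:E - g w <= conjugate g y)%E.
Proof. by apply: ereal_sup_ubound; exists w. Qed.

Lemma conjugate_neqNy (y : Y) : conjugate g y != -oo%E.
Proof.
have [gNy [w gw]] := g_proper.
have gw_fin : g w \is a fin_num by rewrite fin_numE gNy lt_eqF.
have := conjugate_ge y w; rewrite -(fineK gw_fin) -EFinB.
by case: (conjugate g y).
Qed.

Lemma conjugate_weakly_convex : weakly_convex 0 (conjugate g).
Proof.
move=> y1 y2 l /andP[l0 l1].
rewrite mul0r mulr0 mul0r adde0.
apply: ge_ereal_sup => _ [w _ <-].
have [gNy _] := g_proper.
have [gw|gw] := eqVneq (g w) +oo%E; first by rewrite gw leNye.
have gw_fin : g w \is a fin_num by rewrite fin_numE gNy.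
have bound y := conjugate_ge y w.
move: bound; rewrite -(fineK gw_fin) => bound.
rewrite -EFinB.
have -> : dotp (l *: y1 + (1 - l) *: y2) w - fine (g w) =
  l * (dotp y1 w - fine (g w)) + (1 - l) * (dotp y2 w - fine (g w)).
  by rewrite dotpDl !dotpZl; ring.
rewrite EFinD !EFinM.
by apply: leeD; apply: lee_wpmul2l; rewrite ?EFinB// lee_fin subr_ge0.
Qed.

(** A conjugate is a supremum of continuous affine functions. *)
Lemma conjugate_lsc : lower_semicontinuous (conjugate g).
Proof.
move=> y a /ereal_sup_gt[_ [w _ <-] aw].
have [gNy _] := g_proper.
have gw_fin : g w \is a fin_num.
  by rewrite fin_numE gNy; apply/eqP => gw; move: aw; rewrite gw.
exists [set v | a + fine (g w) < dotp w v].
  have: \forall v \near y, a + fine (g w) < dotp w v; last by [].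
  apply: (cvgr_gt (dotp w y)); first exact: dotp_continuous.
  move: aw; rewrite -(fineK gw_fin) -EFinB lte_fin dotpC /=; lra.
move=> v /= av; apply: lt_le_trans (conjugate_ge v w).
rewrite -(fineK gw_fin) -EFinB lte_fin dotpC; lra.
Qed.

End Conjugate.

(** * Saddle points *)

Section SaddlePoints.
Context {R : realType} {X Y : hilbertType R}.
Variables (f : X -> \bar R) (g : Y -> \bar R) (L : {linear X -> Y}).
Hypotheses (f_proper : proper_fun f) (g_proper : proper_fun g).

Local Notation gs := (conjugate g).
Local Notation S := (saddle_points f g L).


(** If the conjugate were +oo everywhere, the Lagrangian would be -oo
    everywhere, so every pair would be a saddle point and the modified gap
    would be -oo, below the nonnegative multiple of the distance. *)
Lemma inf_sharp_conjugate_dom (mu : R) :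
  inf_sharp f g L mu -> exists y, gs y \is a fin_num.
Proof.
move=> [_ sharp]; apply: contrapT => no_dom.
have gsE y : gs y = +oo%E.
  case E : (gs y) => [r| |] //; first by case: no_dom; exists y; rewrite E.
  by have := conjugate_neqNy g_proper y; rewrite E.
have lagE u v : lagrangian f g L u v = -oo%E by rewrite /lagrangian gsE addeNy.
have S0 : S 0 by move=> u v; rewrite !lagE.
have := sharp 0; rewrite leNgt => /negP; apply.
apply: le_lt_trans (ltNyr _).
apply: ereal_inf_lbound; exists 0 => //.
by rewrite !lagE.
Qed.

Lemma lagrangian_fin (u : X) (v : Y) :
  f u \is a fin_num -> gs v \is a fin_num ->
  lagrangian f g L u v = (fine (f u) + dotp (L u) v - fine (gs v))%:E.
Proof. by move=> fu gv; rewrite /lagrangian -{1}(fineK fu) -{1}(fineK gv). Qed.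

Lemma saddle_point_fin (s : X * Y) : (exists y, gs y \is a fin_num) -> S s ->
  f s.1 \is a fin_num /\ gs s.2 \is a fin_num.
Proof.
move=> [v gv] hs.
have [fNy [u fu]] := f_proper.
have {}fu : f u \is a fin_num by rewrite fin_numE fNy lt_eqF.
have gs2 : gs s.2 \is a fin_num.
  rewrite fin_numE conjugate_neqNy//=; apply/eqP => gs2.
  have [+ _] := hs s.1 v; rewrite {2}/lagrangian gs2 addeNy leeNy_eq => /eqP.
  rewrite /lagrangian -(fineK gv).
  by have := fNy s.1; case: (f s.1).
split => //.
rewrite fin_numE fNy /=; apply/eqP => fs1.
have [_] := hs u s.2; rewrite (lagrangian_fin fu gs2).
by rewrite /lagrangian fs1 -(fineK gs2).
Qed.

(** The two saddle inequalities say that the Lagrangian at (s.1, v) is at most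
    the Lagrangian at (u, s.2); collecting the finite terms on the right leaves
    no subtraction of infinities. *)
Lemma saddle_pointP (s : X * Y) : (exists y, gs y \is a fin_num) ->
  S s <-> forall u v (a b : R), f u = a%:E -> gs v = b%:E ->
    (f s.1 + gs s.2 <= (a + b + dotp (L u) s.2 - dotp (L s.1) v)%:E)%E.
Proof.
move=> gdom; have [fNy [u0 fu0]] := f_proper.
have {}fu0 : f u0 \is a fin_num by rewrite fin_numE fNy lt_eqF.
split=> [hs u v a b fu gv|hs].
  have [fs1 gs2] := saddle_point_fin gdom hs.
  have [h1 _] := hs u v; have [_ h2] := hs u v.
  have := le_trans h1 h2; rewrite !lagrangian_fin ?fu ?gv//= lee_fin.
  rewrite -{2}(fineK fs1) -{2}(fineK gs2) -EFinD lee_fin; lra.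
have [v0 gv0] := gdom.
have [fs1 gs2] : f s.1 \is a fin_num /\ gs s.2 \is a fin_num.
  have := hs u0 v0 _ _ (esym (fineK fu0)) (esym (fineK gv0)).
  have := fNy s.1; have := conjugate_neqNy g_proper s.2.
  by case: (f s.1) => [?||]; case: (gs s.2) => [?||].
have le u v : f u \is a fin_num -> gs v \is a fin_num ->
    fine (f s.1) + fine (gs s.2) <=
    fine (f u) + fine (gs v) + dotp (L u) s.2 - dotp (L s.1) v.
  move=> fu gv; have := hs u v _ _ (esym (fineK fu)) (esym (fineK gv)).
  by rewrite -{1}(fineK fs1) -{1}(fineK gs2) -EFinD lee_fin.
move=> u v; split.
  have [gv|] := boolP (gs v \is a fin_num).
    by rewrite !lagrangian_fin// lee_fin; have := le s.1 v fs1 gv; lra.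
  rewrite fin_numE conjugate_neqNy//= negbK => /eqP gv.
  by rewrite {1}/lagrangian gv addeNy leNye.
have [fu|] := boolP (f u \is a fin_num).
  by rewrite !lagrangian_fin// lee_fin; have := le u s.2 fu gs2; lra.
rewrite fin_numE fNy /= negbK => /eqP fu.
by rewrite {2}/lagrangian fu -(fineK gs2) leey.
Qed.

(** In the inequality of [saddle_pointP] the left-hand side is lower
    semicontinuous in s and the right-hand side is continuous. *)
Lemma closed_saddle_points : lower_semicontinuous f ->
  bounded_operator L -> (exists y, gs y \is a fin_num) -> closed S.
Proof.
move=> f_lsc L_bounded gdom z z_cl.
have gs_lsc := conjugate_lsc g_proper.
apply/saddle_pointP => // u v a b fu gv.
set B := a + b + dotp (L u) z.2 - dotp (L z.1) v.
(* Bounds r < f z.1 and t < gs z.2 persist at saddle points close to z, which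
   transfers the inequality to r + t. *)
have rt_le r t : (r%:E < f z.1)%E -> (t%:E < gs z.2)%E -> r + t <= B.
  move=> /f_lsc[V1 V1z V1f] /gs_lsc[V2 V2z V2g].
  rewrite leNgt; apply/negP => B_lt.
  pose rhs (s : X * Y) : R := a + b + dotp (L u) s.2 - dotp (L s.1) v.
  have rhs_cont : rhs s @[s --> z] --> rhs z.
    apply: cvgB; first apply: cvgD; first exact: cvg_cst.
      apply: (@cvg_comp _ _ _ snd (dotp (L u)) _ (nbhs z.2)).
        exact: cvg_snd.
      exact: dotp_continuous.
    have -> : (fun s : X * Y => dotp (L s.1) v) = (fun s => dotp v (L s.1)).
      by apply/funext => s; rewrite dotpC.
    rewrite (dotpC (L z.1)).
    apply: (@cvg_comp _ _ _ (fun s : X * Y => L s.1) (dotp v) _ (nbhs (L z.1))).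
      apply: (@cvg_comp _ _ _ fst L _ (nbhs z.1)); first exact: cvg_fst.
      exact: bounded_operator_continuous.
    exact: dotp_continuous.
  have near_z : nbhs z [set s | [/\ V1 s.1, V2 s.2 & rhs s < r + t]].
    have n1 : \forall s \near z, V1 s.1 by apply: cvg_fst.
    have n2 : \forall s \near z, V2 s.2 by apply: cvg_snd.
    have n3 : \forall s \near z, rhs s < r + t.
      by exact: (cvgr_lt _ rhs_cont _ B_lt).
    by near=> s; split; near: s.
  have [s [hs [/V1f fs /V2g gss]]] := z_cl _ near_z.
  apply/negP; rewrite -leNgt.
  have := (saddle_pointP s gdom).1 hs _ _ _ _ fu gv.
  rewrite -lee_fin; apply: le_trans.
  by rewrite EFinD; apply: ltW; exact: lteD.
have below (e : \bar R) : e != -oo%E -> exists r : R, (r%:E < e)%E.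
  case: e => [r| |] // _; first by exists (r - 1); rewrite lte_fin; lra.
  by exists 0; rewrite ltry.
have [r0 hr0] := below _ (f_proper.1 z.1).
have [t0 ht0] := below _ (conjugate_neqNy g_proper z.2).
case Ef : (f z.1) (f_proper.1 z.1) => [F| |] // _; last first.
  have := rt_le (B - t0 + 1) t0; rewrite Ef ltry => /(_ isT ht0).
  by rewrite addrAC subrK gerDl ler10.
case Eg : (gs z.2) (conjugate_neqNy g_proper z.2) => [G| |] // _; last first.
  have := rt_le r0 (B - r0 + 1); rewrite Eg ltry => /(_ hr0 isT).
  by rewrite addrA (addrC r0) subrK gerDl ler10.
clear hr0 ht0; rewrite -EFinD lee_fin; apply/ler_addgt0Pr => e e0.
have := rt_le (F - e / 2) (G - e / 2); rewrite Ef Eg !lte_fin.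
have -> : F - e / 2 < F by lra.
have -> : G - e / 2 < G by lra.
move=> /(_ isT isT); lra.
Unshelve. all: by end_near.
Qed.

End SaddlePoints.

(** * Convergence from a sharp decrease of the distance *)

Section SharpDecrease.
Context {R : realType} {X Y : hilbertType R} (S : set (X * Y)).
Hypothesis S0 : S !=set0.
Implicit Types (z s : X * Y).

Lemma prod_norm_sqr z : prod_norm z ^+ 2 = `|z.1| ^+ 2 + `|z.2| ^+ 2.
Proof. by rewrite sqr_sqrtr// addr_ge0. Qed.

Lemma prod_norm_ge0 z : 0 <= prod_norm z.
Proof. exact: sqrtr_ge0. Qed.

Lemma norm_fst_le z : `|z.1| <= prod_norm z.
Proof.
by rewrite -(@ler_pXn2r _ 2)// ?nnegrE ?prod_norm_ge0// prod_norm_sqr lerDl.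
Qed.

Lemma norm_snd_le z : `|z.2| <= prod_norm z.
Proof.
by rewrite -(@ler_pXn2r _ 2)// ?nnegrE ?prod_norm_ge0// prod_norm_sqr lerDr.
Qed.

Lemma le_dist z (a : R) : (forall s, S s -> a <= prod_norm (z - s)) ->
  a <= dist z S.
Proof.
move=> ha; apply: lb_le_inf; last by move=> _ [s /ha ? <-].
by have [s Ss] := S0; exists (prod_norm (z - s)); exists s.
Qed.

Lemma dist_le z s : S s -> dist z S <= prod_norm (z - s).
Proof.
move=> Ss; apply: ge_inf; last by exists s.
by exists 0 => _ [t _ <-]; exact: prod_norm_ge0.
Qed.

Lemma dist_ge0 z : 0 <= dist z S.
Proof. by apply: le_dist => s _; exact: prod_norm_ge0. Qed.

(** Squaring is increasing on nonnegative reals, so it commutes with the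
    infimum that defines the distance. *)
Lemma le_dist_sqr z (V M : R) : 0 < M ->
  (forall s, S s -> V <= M * prod_norm (z - s) ^+ 2) -> V <= M * dist z S ^+ 2.
Proof.
move=> M0 hV; have [V0|V0] := leP V 0.
  by rewrite (le_trans V0)// mulr_ge0 ?sqr_ge0// ltW.
have VM0 : 0 <= V / M by rewrite divr_ge0 ?ltW.
rewrite mulrC -ler_pdivrMr// -(sqr_sqrtr VM0).
rewrite lerXn2r ?nnegrE ?sqrtr_ge0 ?dist_ge0//; apply: le_dist => s /hV.
rewrite mulrC -ler_pdivrMr// => h.
by rewrite -[leRHS]ger0_norm ?prod_norm_ge0// -sqrtr_sqr ler_wsqrtr.
Qed.

Variables (z : nat -> X * Y) (A M mu : R).
Hypotheses (A0 : 0 < A) (M0 : 0 < M) (mu0 : 0 < mu).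
Hypothesis decrease : forall n s, S s ->
  mu * dist (z n.+1) S + A * prod_norm (z n.+1 - s) ^+ 2
    <= M * prod_norm (z n - s) ^+ 2.
Hypothesis start : (M - A) * dist (z 0%N) S < mu.

Lemma dist_decrease n :
  mu * dist (z n.+1) S + A * dist (z n.+1) S ^+ 2 <= M * dist (z n) S ^+ 2.
Proof.
apply: le_dist_sqr => // s Ss; apply: le_trans (decrease n Ss).
rewrite lerD2l ler_pM2l// lerXn2r ?nnegrE ?dist_ge0 ?prod_norm_ge0//.
exact: dist_le.
Qed.

(** Write d0 for the initial distance.  The starting condition is the strict
    inequality d0 * (M - A * q^2) < mu * q at q = 1, so the weak inequality
    still holds for some q < 1.  As long as the distance d is at most d0, a
    next distance above q * d would make the left-hand side of
    [dist_decrease] larger than its right-hand side. *)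
Lemma dist_linear_rate : exists2 q, 0 <= q < 1 &
  forall n, dist (z n) S <= dist (z 0%N) S * q ^+ n.
Proof.
set d0 := dist (z 0%N) S; have start_d0 : (M - A) * d0 < mu by [].
have d00 : 0 <= d0 by exact: dist_ge0.
set P := mu - (M - A) * d0.
have P0 : 0 < P by rewrite /P subr_gt0.
set K := mu + 2 * d0 * A.
have K0 : 0 < K by rewrite /K ltr_wpDr// !mulr_ge0// ltW.
have KP0 : 0 < K + P by exact: addr_gt0.
(* Moving q down from 1 costs at most (1 - q) * K of the slack P. *)
pose q := K / (K + P).
have q0 : 0 < q by exact: divr_gt0.
have q1 : q < 1 by rewrite ltr_pdivrMr// mul1r ltrDl.
have qP : (1 - q) * K <= P.
  have -> : 1 - q = P / (K + P) by rewrite /q; field; rewrite gt_eqF.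
  rewrite mulrAC ler_pdivrMr// ler_wpM2l ?(ltW P0)//; lra.
have rate : d0 * (M - A * q ^+ 2) <= mu * q.
  have : 0 <= d0 * A * (1 - q) ^+ 2.
    by rewrite mulr_ge0 ?sqr_ge0// mulr_ge0// ltW.
  by move: qP; rewrite /K /P; lra.
exists q; first by rewrite ltW.
elim=> [|n IHn]; first by rewrite expr0 mulr1.
have dn0 := dist_ge0 (z n); have dn10 := dist_ge0 (z n.+1).
have dn : dist (z n) S <= d0.
  by apply: le_trans IHn _; rewrite ler_piMr// exprn_ile1// ltW.
suff : dist (z n.+1) S <= q * dist (z n) S.
  by move=> /le_trans; apply; rewrite exprS mulrCA ler_pM2l.
rewrite leNgt; apply/negP => slow.
have := dist_decrease n.
set d := dist (z n) S in dn0 dn slow *.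
set d' := dist (z n.+1) S in dn10 slow *.
apply/negP; rewrite -ltNge.
apply: (@le_lt_trans _ _ (mu * (q * d) + A * (q * d) ^+ 2)).
  have : (M - A * q ^+ 2) * d <= mu * q.
    have [pos|neg] := leP 0 (M - A * q ^+ 2).
      by apply: le_trans rate; rewrite mulrC ler_wpM2r.
    apply: (@le_trans _ _ 0); first by rewrite mulr_le0_ge0// ltW.
    by rewrite mulr_ge0// ltW.
  by move=> /(ler_wpM2r dn0); lra.
have qd0 : 0 <= q * d by rewrite mulr_ge0// ltW.
apply: ltr_leD; first by rewrite ltr_pM2l.
by rewrite ler_pM2l// lerXn2r// ?nnegrE// ltW.
Qed.

Lemma prod_norm_step n s : S s ->
  prod_norm (z n.+1 - s) <= Num.sqrt (M / A) * prod_norm (z n - s).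
Proof.
move=> Ss.
rewrite -(@ler_pXn2r _ 2)// ?nnegrE ?mulr_ge0 ?sqrtr_ge0//.
have MA0 : 0 <= M / A by rewrite divr_ge0 ?ltW.
rewrite exprMn (sqr_sqrtr MA0) mulrAC ler_pdivlMr// mulrC.
apply: le_trans (decrease n Ss).
by rewrite lerDr mulr_ge0 ?dist_ge0// ltW.
Qed.

(** With a the length of a component of the increment, the hypothesis is the
    triangle inequality through s; choosing s almost nearest to z n bounds the
    increment by a multiple of the distance. *)
Lemma increment_le_dist n (a : R) :
  (forall s, a <= prod_norm (z n.+1 - s) + prod_norm (z n - s)) ->
  a <= (Num.sqrt (M / A) + 1) * dist (z n) S.
Proof.
move=> ha.
have K0 : 0 < Num.sqrt (M / A) + 1 by rewrite ltr_wpDl ?sqrtr_ge0.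
rewrite mulrC -ler_pdivrMr//; apply: le_dist => s Ss.
rewrite ler_pdivrMr// mulrC mulrDl mul1r.
by rewrite (le_trans (ha s))// lerD2r prod_norm_step.
Qed.

(** The increments are geometrically small because the distances are, hence
    the sequence converges; its limit is at distance 0 from the closed set S. *)
Lemma sharp_decrease_cvg : closed S ->
  exists2 s, S s & z @ \oo --> s.
Proof.
move=> S_closed.
have [q /andP[q0 q1] dist_q] := dist_linear_rate.
set C := (Num.sqrt (M / A) + 1) * dist (z 0%N) S.
have incr n (a : R) :
    (forall s, a <= prod_norm (z n.+1 - s) + prod_norm (z n - s)) ->
    a <= C * q ^+ n.
  move=> /increment_le_dist ha; apply: le_trans ha _.
  by rewrite /C -mulrA ler_wpM2l// addr_ge0 ?sqrtr_ge0.
have cvg1 : cvgn (fst \o z).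
  apply: (@cvg_geometric_increments _ _ C q); first by rewrite q0.
  move=> n; apply: incr => s /=.
  have -> : (z n.+1).1 - (z n).1 = (z n.+1 - s).1 - (z n - s).1.
    by rewrite /= opprB addrA subrK.
  by rewrite (le_trans (ler_normB _ _))// lerD// norm_fst_le.
have cvg2 : cvgn (snd \o z).
  apply: (@cvg_geometric_increments _ _ C q); first by rewrite q0.
  move=> n; apply: incr => s /=.
  have -> : (z n.+1).2 - (z n).2 = (z n.+1 - s).2 - (z n - s).2.
    by rewrite /= opprB addrA subrK.
  by rewrite (le_trans (ler_normB _ _))// lerD// norm_snd_le.
pose zs := (lim ((fst \o z) @ \oo), lim ((snd \o z) @ \oo)).
have z_cvg : z @ \oo --> zs.
  have -> : z = fun n => ((z n).1, (z n).2).
    by apply/funext => n; case: (z n).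
  exact: cvg_pair.
exists zs => //.
apply: S_closed => B /nbhs_ballP[e /= e0 eB].
have e20 : 0 < e / 2 by rewrite divr_gt0.
have dq_cvg : dist (z 0%N) S * q ^+ n @[n --> \oo] --> dist (z 0%N) S * 0.
  by apply: cvgM; [exact: cvg_cst|apply: cvg_expr; rewrite ger0_norm].
have near_d : \forall n \near \oo, dist (z 0%N) S * q ^+ n < e / 2.
  by apply: (cvgr_lt _ dq_cvg); rewrite mulr0.
have near_z : \forall n \near \oo, ball zs (e / 2) (z n).
  by move/cvg_ballP : z_cvg; exact.
have [n [dn zn]] := filter_ex (filterI near_d near_z).
have /(inf_lt _)[] : dist (z n) S < e / 2 by exact: le_lt_trans (dist_q n) dn.
  by have [s Ss] := S0; exists (prod_norm (z n - s)); exists s.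
move=> _ [s Ss <-] sn; exists s; split=> //.
apply: eB; rewrite [e]splitr; apply: ball_triangle zn _.
split; rewrite /= -ball_normE /=.
  exact: le_lt_trans (norm_fst_le (z n - s)) sn.
exact: le_lt_trans (norm_snd_le (z n - s)) sn.
Qed.

End SharpDecrease.

(** * One step of the algorithm *)

Section PrimalDualStep.
Context {R : realType} {X Y : hilbertType R}.
Variables (f : X -> \bar R) (g : Y -> \bar R) (L : {linear X -> Y}).
Variables (rho sigma tau theta : R) (x xbar : nat -> X) (y : nat -> Y).
Hypotheses (f_proper : proper_fun f) (f_weakly_convex : weakly_convex rho f).
Hypotheses (g_proper : proper_fun g) (L_bounded : bounded_operator L).
Hypothesis gdom : exists v, conjugate g v \is a fin_num.
Hypothesis algo : primal_first f g L rho sigma tau theta x xbar y.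

Local Notation gs := (conjugate g).
Local Notation S := (saddle_points f g L).

Let sigma0 : 0 < sigma := pf_sigma_gt0 algo.
Let tau0 : 0 < tau := pf_tau_gt0 algo.

Lemma primal_argmin n :
  argmin (fun u => f u + ((2 * sigma)^-1 *
    `|u - (x n - sigma *: adjoint L (y n))| ^+ 2)%:E)%E (x n.+1).
Proof.
move=> u; have := pf_x_step algo n u.
by rewrite !opprB !addrA !(addrAC _ (sigma *: _)).
Qed.

Lemma dual_argmin n :
  argmin (fun v => gs v + ((2 * tau)^-1 *
    `|v - (y n + tau *: L (xbar n.+1))| ^+ 2)%:E)%E (y n.+1).
Proof. by move=> v; have := pf_y_step algo n v; rewrite !opprD !addrA. Qed.

Lemma primal_iterate_fin n : f (x n.+1) \is a fin_num.
Proof. exact: argmin_dom f_proper (primal_argmin n). Qed.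

Lemma dual_iterate_fin n : gs (y n.+1) \is a fin_num.
Proof.
apply: argmin_dom (dual_argmin n); split; first exact: conjugate_neqNy.
have [v gv] := gdom; exists v; move: gv.
by rewrite fin_numE => /andP[_]; rewrite -ltey.
Qed.

Lemma primal_step n u (hu : R) : f u = hu%:E ->
  fine (f (x n.+1)) + dotp (L (x n.+1)) (y n) +
    (2 * sigma)^-1 * `|x n.+1 - x n| ^+ 2 +
    ((2 * sigma)^-1 - rho / 2) * `|u - x n.+1| ^+ 2
  <= hu + dotp (L u) (y n) + (2 * sigma)^-1 * `|u - x n| ^+ 2.
Proof.
move=> fu.
have := proximal_inequality f_weakly_convex (primal_argmin n)
  (esym (fineK (primal_iterate_fin n))) fu.
have expand (v : X) :
  (2 * sigma)^-1 * `|v - (x n - sigma *: adjoint L (y n))| ^+ 2 =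
  (2 * sigma)^-1 * `|v - x n| ^+ 2 +
    (dotp (L v) (y n) - dotp (L (x n)) (y n)) +
      (2 * sigma)^-1 * `|sigma *: adjoint L (y n)| ^+ 2.
  have -> : v - (x n - sigma *: adjoint L (y n)) =
    v - x n + sigma *: adjoint L (y n) by rewrite opprB addrA addrAC.
  rewrite (normD_sqr (v - x n)) dotpZr dotpBl -!adjointP//.
  by field; rewrite gt_eqF.
rewrite !expand; lra.
Qed.

Lemma dual_step n v (hv : R) : gs v = hv%:E ->
  fine (gs (y n.+1)) - dotp (L (xbar n.+1)) (y n.+1) +
    (2 * tau)^-1 * `|y n.+1 - y n| ^+ 2 + (2 * tau)^-1 * `|v - y n.+1| ^+ 2
  <= hv - dotp (L (xbar n.+1)) v + (2 * tau)^-1 * `|v - y n| ^+ 2.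
Proof.
move=> gv.
have := proximal_inequality (conjugate_weakly_convex g_proper) (dual_argmin n)
  (esym (fineK (dual_iterate_fin n))) gv.
have expand (w : Y) :
  (2 * tau)^-1 * `|w - (y n + tau *: L (xbar n.+1))| ^+ 2 =
  (2 * tau)^-1 * `|w - y n| ^+ 2 -
    (dotp (L (xbar n.+1)) w - dotp (L (xbar n.+1)) (y n)) +
      (2 * tau)^-1 * `|tau *: L (xbar n.+1)| ^+ 2.
  rewrite opprD addrA (normB_sqr (w - y n)) dotpZr dotpBl.
  rewrite !(dotpC _ (L (xbar n.+1))).
  by field; rewrite gt_eqF.
rewrite !expand; lra.
Qed.

Hypothesis rho_ge0 : 0 <= rho.
Hypothesis stepsizes : sigma * rho + Num.sqrt (sigma * tau) * opnorm L < 1.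

Local Notation A1 := (stepsize_A1 L rho sigma tau theta).
Local Notation M := (Num.max (2 * sigma)^-1 (2 * tau)^-1).

(** Adding [primal_step] at s.1 and [dual_step] at s.2 leaves the two
    coupling terms
      dotp (L (x n.+1 - s.1)) (y n.+1 - y n) and
      theta * dotp (L (x n.+1 - x n)) (y n.+1 - s.2).
    [opnorm_young] splits them: the parts in the increments are absorbed by
    the increment terms of the proximal inequalities, and the parts in the
    distances to s lower the coefficients of these distances to those whose
    minimum is A1. *)
Lemma gap_decrease n (s : X * Y) : S s ->
  exists gap : R,
    (lagrangian f g L (x n.+1) s.2 - lagrangian f g L s.1 (y n.+1)
      = gap%:E)%E /\
    gap + A1 * prod_norm ((x n.+1, y n.+1) - s) ^+ 2
      <= M * prod_norm ((x n, y n) - s) ^+ 2.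
Proof.
move=> Ss; have [fs gs2] := saddle_point_fin f_proper g_proper gdom Ss.
have fx := primal_iterate_fin n; have gy := dual_iterate_fin n.
rewrite !lagrangian_fin// -EFinB; eexists; split; first reflexivity.
have := primal_step n (esym (fineK fs)).
have := dual_step n (esym (fineK gs2)).
have := opnorm_young L_bounded (x n.+1 - s.1) (y n.+1 - y n) sigma0 tau0.
have /andP[th0 th1] := pf_theta_itv algo.
have := ler_wpM2l th0
  (opnorm_young L_bounded (x n.+1 - x n) (y n.+1 - s.2) sigma0 tau0).
rewrite !prod_norm_sqr /= (pf_xbar_step algo n).
have LD u v : L (u + v) = L u + L v by rewrite linearD.
have LN u : L (- u) = - L u by rewrite linearN.
have LZ a u : L (a *: u) = a *: L u by rewrite linearZ.
rewrite !(LD, LZ, LN).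
rewrite !(dotpDl, dotpNl, dotpZl, dotpBr).
rewrite (distrC s.1 (x n.+1)) (distrC s.1 (x n)).
rewrite (distrC s.2 (y n.+1)) (distrC s.2 (y n)).
set nu := Num.sqrt (sigma * tau) * opnorm L.
have stepsizes_nu : sigma * rho + nu < 1 := stepsizes.
have nu0 : 0 <= nu by rewrite mulr_ge0 ?sqrtr_ge0 ?opnorm_ge0.
have nu1 : nu < 1.
  by have := mulr_ge0 (ltW sigma0) rho_ge0; lra.
have k0 : 0 < (2 * tau)^-1 by rewrite invr_gt0 mulr_gt0.
have c0 : 0 < (2 * sigma)^-1 by rewrite invr_gt0 mulr_gt0.
have A_dual : A1 <= (2 * tau)^-1 - theta * nu * (2 * tau)^-1.
  by rewrite ge_min; apply/orP; left; rewrite -mulrA -/nu mulrBl mul1r.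
have A_primal : A1 <= (2 * sigma)^-1 - rho / 2 - nu * (2 * sigma)^-1.
  rewrite ge_min; apply/orP; right; rewrite -/nu le_eqVlt; apply/orP; left.
  by apply/eqP; field; rewrite gt_eqF.
have M_primal : (2 * sigma)^-1 <= M by rewrite le_max lexx.
have M_dual : (2 * tau)^-1 <= M by rewrite le_max lexx orbT.
set c := (2 * sigma)^-1 in c0 A_primal M_primal *.
set k := (2 * tau)^-1 in k0 A_dual M_dual *.
set a := `|x n.+1 - s.1| ^+ 2; set b := `|y n.+1 - s.2| ^+ 2.
set a' := `|x n - s.1| ^+ 2; set b' := `|y n - s.2| ^+ 2.
set p := `|x n.+1 - x n| ^+ 2; set r := `|y n.+1 - y n| ^+ 2.
have := ler_wpM2r (sqr_ge0 _ : 0 <= a) A_primal.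
have := ler_wpM2r (sqr_ge0 _ : 0 <= b) A_dual.
have := ler_wpM2r (sqr_ge0 _ : 0 <= a') M_primal.
have := ler_wpM2r (sqr_ge0 _ : 0 <= b') M_dual.
have : 0 <= (1 - theta * nu) * (c * p).
  rewrite !mulr_ge0 ?sqr_ge0 ?(ltW c0)// subr_ge0.
  by rewrite mulr_ile1 ?(ltW nu1).
have : 0 <= (1 - nu) * (k * r).
  by rewrite !mulr_ge0 ?sqr_ge0 ?(ltW k0)// subr_ge0 ltW.
lra.
Qed.

Lemma stepsize_A1_gt0 : 0 < A1.
Proof.
rewrite /stepsize_A1 -mulrA; set nu := Num.sqrt (sigma * tau) * opnorm L.
have stepsizes_nu : sigma * rho + nu < 1 := stepsizes.
have nu0 : 0 <= nu by rewrite mulr_ge0 ?sqrtr_ge0 ?opnorm_ge0.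
have sr0 := mulr_ge0 (ltW sigma0) rho_ge0.
have /andP[_ th1] := pf_theta_itv algo.
rewrite lt_min; apply/andP; split; apply: divr_gt0; rewrite ?mulr_gt0//.
  have := ler_wpM2r nu0 th1; rewrite mul1r; lra.
lra.
Qed.

Lemma stepsize_A1_le : A1 <= M.
Proof.
have /andP[th0 _] := pf_theta_itv algo.
rewrite ge_min le_max; apply/orP; left; apply/orP; right.
rewrite -[leRHS]mul1r; apply: ler_wpM2r.
  by rewrite invr_ge0 mulr_ge0// ltW.
by rewrite gerBl !mulr_ge0 ?sqrtr_ge0 ?opnorm_ge0.
Qed.

End PrimalDualStep.

(* The bound on the starting point is written with extended-real division, for
   which mu / 0 = +oo: the denominator is nonnegative and vanishes only when
   L = 0, rho = 0 and sigma = tau. *)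
Theorem theorem3 (R : realType) (X Y : hilbertType R)
  (f : X -> \bar R) (g : Y -> \bar R) (L : {linear X -> Y})
  (rho sigma tau theta mu : R)
  (x xbar : nat -> X) (y : nat -> Y)
  (rho_ge0 : 0 <= rho)
  (f_proper : proper_fun f) (f_lsc : lower_semicontinuous f)
  (f_weakly_convex : weakly_convex rho f)
  (g_proper : proper_fun g) (g_lsc : lower_semicontinuous g)
  (g_convex : convex g)
  (L_bounded : bounded_operator L)
  (algo : primal_first f g L rho sigma tau theta x xbar y)
  (stepsizes : sigma * rho + Num.sqrt (sigma * tau) * opnorm L < 1)
  (S_nonempty : saddle_points f g L !=set0)
  (sharp : inf_sharp f g L mu)
  (start : ((dist (x 0%N, y 0%N) (saddle_points f g L))%:E <
    mu%:E / (Num.max (2 * sigma)^-1 (2 * tau)^-1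
             - stepsize_A1 L rho sigma tau theta)%:E)%E) :
  exists2 s : X * Y, saddle_points f g L s &
    (fun n => (x n, y n)) @ \oo --> s.
Proof.
have gdom := inf_sharp_conjugate_dom g_proper sharp.
have [mu0 gap_ge] := sharp.
have A0 := stepsize_A1_gt0 L_bounded algo rho_ge0 stepsizes.
have AM := stepsize_A1_le L_bounded algo.
have S_closed := closed_saddle_points f_proper g_proper f_lsc L_bounded gdom.
apply: (@sharp_decrease_cvg _ _ _ _ S_nonempty (fun n => (x n, y n)) _ _ mu
  A0 (lt_le_trans A0 AM) mu0 _ _ S_closed).
- move=> n s Ss.
  have [gap [gapE]] := gap_decrease f_proper f_weakly_convex g_proper
    L_bounded gdom algo rho_ge0 stepsizes n Ss.
  apply: le_trans; rewrite lerD2r -lee_fin -gapE.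
  apply: le_trans (gap_ge _) _.
  by apply: ereal_inf_lbound; exists s.
- move: start; set A1 := stepsize_A1 _ _ _ _ _ in AM *.
  set M := Num.max _ _ in AM *; set d := dist _ _.
  have [->|MA] := eqVneq M A1; first by rewrite subrr mul0r.
  have MA0 : 0 < M - A1 by rewrite subr_gt0 lt_neqAle eq_sym MA.
  by rewrite inver gt_eqF// -EFinM lte_fin ltr_pdivlMr// mulrC.
Qed.
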